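(* Let $c\ge0$ be a fixed integer and let $\widetilde{K}_{c,n}$ be the graph obtained from the complete bipartite graph $K_{c,n}$ by adding, for each vertex $v$, a new vertex $v'$ adjacent only to $v$. Then $\lim_{n\to\infty}\mathcal{I}(\widetilde{K}_{c,n})=1$.
   Context: For a finite simple graph $G$: a matching is a set of pairwise vertex-disjoint edges; it is maximal if not contained in a larger matching. $\nu(G)$ is the maximum matching size, $\mathcal{T}_0(G)$ the number of maximal matchings, $\mathcal{T}_1(G)$ the sum of the sizes of all maximal matchings, and $\mathcal{I}(G)=\frac{\mathcal{T}_1(G)}{\nu(G)\mathcal{T}_0(G)}$ (equal to $1$ by convention if $\nu(G)=0$). *)

(* Defs.v *)
From mathcomp Require Import all_boot all_order all_algebra.

Set Implicit Arguments.
Unset Strict Implicit.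
Unset Printing Implicit Defensive.

Import GRing.Theory Num.Theory.

Record sgraph := SGraph {
  vertex : finType;
  adj : rel vertex;
  adj_sym : symmetric adj;
  adj_irrefl : irreflexive adj
}.

Section Matchings.
Variable G : sgraph.

Definition edges : {set {set vertex G}} :=
  [set e | [exists x : vertex G, exists y : vertex G,
              adj x y && (e == [set x; y])]].

Definition matching (M : {set {set vertex G}}) : bool :=
  (M \subset edges) &&
  [forall e in M, forall f in M, (e != f) ==> [disjoint e & f]].

Definition maximal_matching (M : {set {set vertex G}}) : bool :=
  maxset matching M.

Definition nu : nat :=
  \max_(M : {set {set vertex G}} | matching M) #|M|.

Definition T0 : nat := #|[set M | maximal_matching M]|.

Definition T1 : nat :=
  \sum_(M : {set {set vertex G}} | maximal_matching M) #|M|.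

Definition calI (R : numFieldType) : R :=
  if nu == 0 then 1%R else ((T1%:R : R) / (nu%:R * T0%:R))%R.

End Matchings.

Section CompleteBipartite.
Variables c n : nat.

Definition Kbip_adj : rel ('I_c + 'I_n)%type := fun x y =>
  match x, y with
  | inl _, inr _ | inr _, inl _ => true
  | _, _ => false
  end.

Fact Kbip_sym : symmetric Kbip_adj.
Proof. by do 2 case=> ?. Qed.

Fact Kbip_irrefl : irreflexive Kbip_adj.
Proof. by case. Qed.

Definition Kbip : sgraph := SGraph Kbip_sym Kbip_irrefl.

End CompleteBipartite.

(* [inl v] is the vertex v of G and [inr v] is its new neighbour v'. *)
Section Pendant.
Variable G : sgraph.

Definition pendant_adj : rel (vertex G + vertex G)%type := fun x y =>
  match x, y with
  | inl u, inl v => adj u v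
  | inl u, inr v | inr u, inl v => u == v
  | inr _, inr _ => false
  end.

Fact pendant_sym : symmetric pendant_adj.
Proof. by case=> u; case=> v //=; first exact: adj_sym. Qed.

Fact pendant_irrefl : irreflexive pendant_adj.
Proof. by case=> u //=; exact: adj_irrefl. Qed.

Definition pendant : sgraph := SGraph pendant_sym pendant_irrefl.

End Pendant.

Definition Ktilde (c n : nat) : sgraph := pendant (Kbip c n).

(* Main.v *)
(** Counting the pairs of a vertex in [A] and an edge of a matching [M] that
    contains it shows that [M] has at most [#|A|] edges when [A] is a vertex
    cover, and at least [#|A|] edges when [A] is an independent set all of whose
    vertices are matched. After a pendant edge is attached to every vertex, each
    maximal matching matches every original vertex [v], since otherwise the edge
    from [v] to its pendant neighbour could be added. So if the original graph
    has [m] vertices and an independent set of size [k], the maximal matchings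
    have between [k] and [m] edges, and the average over the maximum is at least
    [k / m]. For [K_{c,n}] this ratio can be taken to be [n / (c + n)]. *)
Require Import Defs.
(* [all_boot] is imported last so that [cover], [trivIset], [set0], ... refer to
   finite sets rather than to classical sets. *)
From mathcomp Require Import all_classical all_reals all_analysis.
From mathcomp Require Import all_boot all_order all_algebra.

Set Implicit Arguments.
Unset Strict Implicit.
Unset Printing Implicit Defensive.

Import GRing.Theory Num.Theory.
Import numFieldNormedType.Exports.

Lemma card_setI_cover (T : finType) (A : {set T}) (P : {set {set T}}) :
  trivIset P -> #|A :&: cover P| = \sum_(B in P) #|A :&: B|.
Proof.
move=> tiP; rewrite setIC -sum1_card.
under eq_bigl do rewrite inE.
rewrite big_trivIset_cond //; apply: eq_bigr => B _.
by rewrite setIC -sum1_card; apply: eq_bigl => x; rewrite inE.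
Qed.

Section Graph.
Variable G : sgraph.
Implicit Types (A S e : {set vertex G}) (M : {set {set vertex G}}).
Implicit Types x y : vertex G.

Definition independent S : bool := [forall x in S, forall y in S, ~~ adj x y].

Definition vertex_cover A : bool :=
  [forall e in edges G, ~~ [disjoint A & e]].

Lemma independentP S :
  reflect {in S &, forall x y, ~~ adj x y} (independent S).
Proof.
apply: (iffP forall_inP) => [indS x y /indS/forall_inP|indS x Sx]; first exact.
by apply/forall_inP => y; apply: indS.
Qed.

Lemma edgesP e :
  reflect (exists x y, adj x y /\ e = [set x; y]) (e \in edges G).
Proof.
rewrite inE; apply: (iffP existsP) => [[x /existsP[y /andP[xy /eqP->]]]|].
  by exists x, y.
by case=> x [y [xy ->]]; exists x; apply/existsP; exists y; rewrite xy eqxx.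
Qed.

Lemma edge_neq0 e : e \in edges G -> e != set0.
Proof.
by case/edgesP => x [y [_ ->]]; apply/set0Pn; exists x; rewrite set21.
Qed.

Lemma edge_incident e x :
  e \in edges G -> x \in e -> exists2 y, adj x y & e = [set x; y].
Proof.
case/edgesP => u [v [uv ->]] /set2P[]->; first by exists v.
by exists u; [rewrite adj_sym | rewrite setUC].
Qed.

Lemma edge_adj e x y : e \in edges G -> x \in e -> y \in e -> x != y -> adj x y.
Proof.
by move=> /edge_incident/[apply] -[z xz ->] /set2P[]-> //; rewrite eqxx.
Qed.

Lemma matchingP M : reflect (M \subset edges G /\ trivIset M) (matching M).
Proof.
apply: (iffP andP) => -[sM dM]; split=> //.
  apply/trivIsetP => e f eM fM ef.
  by move/forall_inP: dM => /(_ e eM) /forall_inP /(_ f fM) /implyP /(_ ef).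
apply/forall_inP => e eM; apply/forall_inP => f fM; apply/implyP.
exact: (trivIsetP dM).
Qed.

Lemma matching0 : matching (set0 : {set {set vertex G}}).
Proof.
apply/matchingP; rewrite sub0set; split=> //.
by apply/trivIsetP => e f; rewrite inE.
Qed.

Lemma set0_notin_sub_edges M : M \subset edges G -> set0 \notin M.
Proof. by move/subsetP => sM; apply/negP => /sM/edge_neq0; rewrite eqxx. Qed.

Lemma matchingU1 M e :
  matching M -> e \in edges G -> [disjoint e & cover M] -> matching (e |: M).
Proof.
move=> /matchingP[sM tM] eE /bigcup_disjointP deM.
apply/matchingP; split; first by rewrite subUset sub1set eE.
by have [] := trivIsetU1 deM tM (set0_notin_sub_edges sM).
Qed.

Lemma maximal_matchingW M : maximal_matching M -> matching M.
Proof. exact: maxsetp. Qed.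

Lemma maximal_matching_vertex_cover M :
  maximal_matching M -> vertex_cover (cover M).
Proof.
move=> /maxsetP[mM maxM]; apply/forall_inP => e eE; apply/negP => deM.
have eM : e \in M.
  rewrite -(maxM (e |: M)) ?setU11 ?subsetUr //.
  by apply: matchingU1; rewrite // disjoint_sym.
have sub_eM : e \subset cover M by exact: bigcup_sup.
by move: deM; rewrite -setI_eq0 (setIidPr sub_eM) (negPf (edge_neq0 eE)).
Qed.

Lemma card_matching_le_vertex_cover M A :
  matching M -> vertex_cover A -> #|M| <= #|A|.
Proof.
move=> /matchingP[/subsetP sM tM] /forall_inP coverA.
apply: leq_trans (subset_leq_card (subsetIl A (cover M))).
rewrite card_setI_cover // -sum1_card; apply: leq_sum => e /sM/coverA.
by rewrite -setI_eq0 card_gt0.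
Qed.

Lemma card_independent_le_matching S M :
  independent S -> matching M -> S \subset cover M -> #|S| <= #|M|.
Proof.
move=> /independentP indS /matchingP[/subsetP sM tM] /setIidPl SM.
rewrite -[in leqLHS]SM card_setI_cover // -sum1_card.
apply: leq_sum => e /sM eE.
apply/card_le1_eqP => x y /setIP[Sx ex] /setIP[Sy ey].
by apply: contraNeq (indS _ _ Sx Sy); rewrite eq_sym; apply: edge_adj ex ey.
Qed.

Lemma card_matching_le_nu M : matching M -> #|M| <= nu G.
Proof. exact: leq_bigmax_cond. Qed.

Lemma T0_gt0 : 0 < T0 G.
Proof.
have [M maxM _] := maxset_exists matching0.
by apply/card_gt0P; exists M; rewrite inE.
Qed.

Lemma T1_le_nu_T0 : T1 G <= nu G * T0 G.
Proof.
rewrite /T0 -sum1dep_card big_distrr /=; apply: leq_sum => M /maximal_matchingW.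
by rewrite muln1; apply: card_matching_le_nu.
Qed.

Lemma T1_ge_mul_T0 k :
  (forall M, maximal_matching M -> k <= #|M|) -> k * T0 G <= T1 G.
Proof.
move=> leM; rewrite /T0 -sum1dep_card big_distrr /=; apply: leq_sum => M /leM.
by rewrite muln1.
Qed.

Lemma calI_le1 (R : numFieldType) : (calI G R <= 1)%R.
Proof.
rewrite /calI; case: (posnP (nu G)) => [//|nu_gt0].
rewrite -natrM ler_pdivrMr ?ltr0n ?muln_gt0 ?nu_gt0 ?T0_gt0 //.
by rewrite mul1r ler_nat T1_le_nu_T0.
Qed.

Lemma calI_ge (R : numFieldType) k :
  (forall M, maximal_matching M -> k <= #|M|) ->
  (k%:R / (nu G)%:R <= calI G R)%R.
Proof.
move=> leM; rewrite /calI; case: (posnP (nu G)) => [->|nu_gt0].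
  by rewrite invr0 mulr0 ler01.
rewrite ler_pdivrMr ?ltr0n // mulrAC -natrM.
rewrite ler_pdivlMr ?ltr0n ?muln_gt0 ?nu_gt0 ?T0_gt0 // -!natrM ler_nat.
by rewrite mulnCA mulnC leq_mul2r T1_ge_mul_T0 ?orbT.
Qed.

End Graph.

Section Pendant.
Variable G : sgraph.
Implicit Types (S : {set vertex G}) (u v : vertex G).

Definition original_vertices : {set vertex (pendant G)} :=
  [set inl v | v : vertex G].

Definition pendant_edge v : {set vertex (pendant G)} := [set inl v; inr v].

Definition pendant_edges : {set {set vertex (pendant G)}} :=
  [set pendant_edge v | v : vertex G].

Lemma pendant_edge_in_edges v : pendant_edge v \in edges (pendant G).
Proof. by apply/edgesP; exists (inl v), (inr v); rewrite /= eqxx. Qed.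

Lemma edge_at_pendant_vertex (e : {set vertex (pendant G)}) v :
  e \in edges (pendant G) -> inr v \in e -> e = pendant_edge v.
Proof.
by move=> /edge_incident/[apply] -[[u /= /eqP->|//] ->]; rewrite setUC.
Qed.

Lemma card_original_vertices : #|original_vertices| = #|vertex G|.
Proof. by rewrite card_imset // => u v []. Qed.

Lemma vertex_cover_original : vertex_cover original_vertices.
Proof.
apply/forall_inP => e eE; have /set0Pn[x xe] := edge_neq0 eE.
have [v ve] : exists v, inl v \in e.
  case: x xe => v ve; first by exists v.
  by exists v; rewrite (edge_at_pendant_vertex eE ve) set21.
by rewrite -setI_eq0; apply/set0Pn; exists (inl v); rewrite inE ve imset_f.
Qed.

Lemma pendant_edge_inj : injective pendant_edge.
Proof.
by move=> u v /setP/(_ (inl u)); rewrite set21 => /esym/set2P[[] | ].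
Qed.

Lemma card_pendant_edges : #|pendant_edges| = #|vertex G|.
Proof. exact: card_imset pendant_edge_inj. Qed.

Lemma disjoint_pendant_edge u v :
  v != u -> [disjoint pendant_edge u & pendant_edge v].
Proof.
move=> neq_vu; rewrite disjoints_subset subUset !sub1set !inE /= !orbF.
by rewrite /eq_op /= eq_sym neq_vu.
Qed.

Lemma matching_pendant_edges : matching pendant_edges.
Proof.
have sub_edges : pendant_edges \subset edges (pendant G).
  by apply/subsetP => _ /imsetP[v _ ->]; apply: pendant_edge_in_edges.
have set0_notin := set0_notin_sub_edges sub_edges.
apply/matchingP; split=> //.
by have [] := trivIimset (in2W disjoint_pendant_edge) set0_notin.
Qed.

Lemma nu_pendant : nu (pendant G) = #|vertex G|.
Proof.
apply/eqP; rewrite eqn_leq; apply/andP; split.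
  apply/bigmax_leqP => M mM; rewrite -card_original_vertices.
  exact: card_matching_le_vertex_cover vertex_cover_original.
by rewrite -card_pendant_edges card_matching_le_nu // matching_pendant_edges.
Qed.

Lemma original_vertex_matched M v :
  @maximal_matching (pendant G) M -> inl v \in cover M.
Proof.
move=> maxM; have /matchingP[/subsetP sM _] := maximal_matchingW maxM.
have /forall_inP/(_ _ (pendant_edge_in_edges v)) :=
  maximal_matching_vertex_cover maxM.
rewrite -setI_eq0 => /set0Pn[x /setIP[xM /set2P[]xE]]; first by rewrite -xE.
move: xM; rewrite xE => /bigcupP[e eM ve]; apply/bigcupP; exists e => //.
by rewrite (edge_at_pendant_vertex (sM e eM) ve) set21.
Qed.

Lemma independent_original S :
  independent S -> @independent (pendant G) [set inl v | v in S].
Proof.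
move=> /independentP indS.
by apply/independentP => _ _ /imsetP[u Su ->] /imsetP[v Sv ->]; apply: indS.
Qed.

Lemma calI_pendant_ge (R : numFieldType) S :
  independent S -> (#|S|%:R / #|vertex G|%:R <= calI (pendant G) R)%R.
Proof.
move=> indS; rewrite -nu_pendant; apply: calI_ge => M maxM.
rewrite -(card_imset S (@inl_inj (vertex G) (vertex G))).
apply: card_independent_le_matching (independent_original indS) _ _.
  exact: maximal_matchingW.
by apply/subsetP => _ /imsetP[v _ ->]; apply: original_vertex_matched.
Qed.

End Pendant.

Section CompleteBipartite.
Variables c n : nat.

Definition right_vertices : {set vertex (Kbip c n)} := [set inr j | j : 'I_n].

Lemma card_right_vertices : #|right_vertices| = n.
Proof. by rewrite card_imset ?card_ord // => i j []. Qed.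

Lemma independent_right_vertices : independent right_vertices.
Proof. by apply/independentP => _ _ /imsetP[i _ ->] /imsetP[j _ ->]. Qed.

Lemma calI_Ktilde_ge (R : numFieldType) :
  (n%:R / (c + n)%:R <= calI (Ktilde c n) R)%R.
Proof.
have := calI_pendant_ge R independent_right_vertices.
by rewrite card_right_vertices card_sum !card_ord.
Qed.

End CompleteBipartite.

Local Open Scope classical_set_scope.
Local Open Scope ring_scope.

Lemma cvg_natr_divD (R : archiRealFieldType) (c : nat) :
  n%:R / (c + n)%:R @[n --> \oo] --> (1 : R).
Proof.
rewrite -(cvg_shiftS (fun n => n%:R / (c + n)%:R : R)) /=.
have -> : (fun n => n.+1%:R / (c + n.+1)%:R) =
          (fun n => 1 - c%:R * harmonic (n + c)%N) :> (nat -> R).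
  apply: boolp.funext => n /=.
  rewrite /harmonic /= addnC -addSn -[n.+1%:R](addrK c%:R) -natrD mulrBl.
  by rewrite divff // pnatr_eq0.
suff : 1 - c%:R * harmonic (n + c)%N @[n --> \oo] --> (1 - c%:R * 0 : R).
  by rewrite mulr0 subr0.
apply: cvgB; first exact: cvg_cst.
apply: cvgM; first exact: cvg_cst.
by rewrite (cvg_shiftn c (@harmonic R)); exact: cvg_harmonic.
Qed.

Theorem theorem12 (R : realType) (c : nat) :
  calI (Ktilde c n) R @[n --> \oo] --> (1 : R).
Proof.
apply: (squeeze_cvgr (f := fun n => n%:R / (c + n)%:R) (h := fun=> 1)).
- by apply: nearW => n; rewrite calI_Ktilde_ge calI_le1.
- exact: cvg_natr_divD.
- exact: cvg_cst.
Qed.
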